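(* Assume the Axiom of Choice. Let $X$ and $Y$ be nonempty sets and let $F\colon X^*\to Y$ be a function. The following conditions are equivalent. (i) $F$ is preassociative (resp. preassociative and standard). (ii) There exist an associative (resp. associative and standard) function $H\colon X^*\to X^*$ and an injective function $f\colon \mathrm{ran}(H)\to Y$ such that $F=f\circ H$. Moreover, the following hold. (a) If condition (ii) holds, then, for $H$ and $f$ as in (ii), we have $f=F|_{\mathrm{ran}(H)}$ and $f^{-1}\in Q(F)$ (where $f^{-1}\colon \mathrm{ran}(f)\to \mathrm{ran}(H)$ is the inverse of $f$ on its range); and in (ii) one may choose $H=g\circ F$ for any $g\in Q(F)$. (b) For any $m\in\mathbb{N}$, the equivalence between (i) and (ii) still holds if we add the condition that $F$ has an $m$-determined range in (i) and the condition that $H$ is $m$-bounded in (ii). In this case the condition $\mathrm{ran}(g)\subseteq\bigcup_{k=0}^m X^k$ must be added in statement (a), i.e., one may choose $H=g\circ F$ for any $g\in Q(F)$ with $\mathrm{ran}(g)\subseteq\bigcup_{k=0}^m X^k$.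
   Context: $X^*=\bigcup_{n\geq 0}X^n$ is the free monoid of strings over $X$ (concatenation written as juxtaposition), with empty string $\varepsilon$, and $|\mathbf{x}|$ is the length of a string. $\mathbb{N}$ is the set of nonnegative integers. $\mathrm{ran}(f)$ denotes the range (image) of $f$, and $\mathrm{id}$ the identity. A function $F\colon X^*\to Y$ is standard if, for all $\mathbf{x}\in X^*$, $F(\mathbf{x})=F(\varepsilon)$ if and only if $\mathbf{x}=\varepsilon$. A function $H\colon X^*\to X^*$ is associative if $H(\mathbf{x}\mathbf{y}\mathbf{z})=H(\mathbf{x}H(\mathbf{y})\mathbf{z})$ for all $\mathbf{x},\mathbf{y},\mathbf{z}\in X^*$. A function $F\colon X^*\to Y$ is preassociative if for all $\mathbf{x},\mathbf{y},\mathbf{y}',\mathbf{z}\in X^*$, $F(\mathbf{y})=F(\mathbf{y}')$ implies $F(\mathbf{x}\mathbf{y}\mathbf{z})=F(\mathbf{x}\mathbf{y}'\mathbf{z})$. $H\colon X^*\to X^*$ is $m$-bounded if $|H(\mathbf{x})|\leq m$ for all $\mathbf{x}\in X^*$. $F_k$ denotes the restriction of $F$ to $X^k$. $F\colon X^*\to Y$ has an $m$-determined range if $\mathrm{ran}(F)=\bigcup_{k=0}^m\mathrm{ran}(F_k)$. A function $g$ is a quasi-inverse of a function $f$ if $f\circ g|_{\mathrm{ran}(f)}=\mathrm{id}|_{\mathrm{ran}(f)}$ and $\mathrm{ran}(g|_{\mathrm{ran}(f)})=\mathrm{ran}(g)$ (in particular $\mathrm{ran}(f)\subseteq\mathrm{dom}(g)$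 and $\mathrm{ran}(g)\subseteq\mathrm{dom}(f)$). $Q(f)$ is the set of quasi-inverses of $f$. *)

(* Defs.v *)
From mathcomp Require Import all_boot.
From mathcomp Require Import boolp classical_sets functions.

Set Implicit Arguments.
Unset Strict Implicit.
Unset Printing Implicit Defensive.

Local Open Scope classical_set_scope.

(* A function whose domain is a set [A : set T] has type [A -> U], i.e. its
   domain is the subtype [set_type A]. *)

Definition corange (A B : Type) (h : A -> B) : A -> range h :=
  fun a => SigSub (mem_set (imageT h a)).

(* Picks some preimage; [range_invK] and [corangeK] show that for injective [h]
   this is the inverse bijection of [corange h]. *)
Definition range_inv (A B : Type) (h : A -> B) : range h -> A :=
  fun b => s2val (cid2 (set_mem (valP b))).

Lemma range_invK (A B : Type) (h : A -> B) (b : range h) :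
  h (range_inv b) = val b.
Proof. by rewrite /range_inv; case: cid2. Qed.

Lemma corangeK (A B : Type) (h : A -> B) :
  injective h -> forall a, range_inv (corange h a) = a.
Proof. by move=> hI a; apply: hI; rewrite range_invK. Qed.

(* [g \in Q(f)], where [g] is defined on [D].  The inclusion of [ran g] in the
   domain of [f] is enforced by typing. *)
Record quasi_inverse (A B : Type) (f : A -> B) (D : set B) (g : D -> A) :
    Prop := QuasiInverse {
  quasi_inverse_dom : range f `<=` D;
  quasi_inverse_id : forall d : D, range f (val d) -> f (g d) = val d;
  quasi_inverse_range : g @` [set d : D | range f (val d)] = range g
}.

(* [g \o f], which is total because [ran f] is included in the domain of [g]. *)
Definition quasi_inverse_comp (A B : Type) (f : A -> B) (D : set B)
    (g : D -> A) (hg : quasi_inverse f g) : A -> A :=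
  fun a => g (SigSub (mem_set (quasi_inverse_dom hg (imageT f a)))).

Section Strings.
Context {X Y : Type}.
Implicit Types (F : seq X -> Y) (H : seq X -> seq X) (x y z : seq X).

Definition standard F := forall x, F x = F [::] <-> x = [::].

Definition str_associative H :=
  forall x y z, H (x ++ y ++ z) = H (x ++ H y ++ z).

Definition preassociative F :=
  forall x y y' z, F y = F y' -> F (x ++ y ++ z) = F (x ++ y' ++ z).

Definition m_bounded (m : nat) H := forall x, (size (H x) <= m)%N.

Definition strings_of_length (k : nat) : set (seq X) := [set x | size x = k].

Definition strings_upto (m : nat) : set (seq X) :=
  \bigcup_(k in [set k | (k <= m)%N]) strings_of_length k.

Definition m_determined_range (m : nat) F :=
  range F =
  \bigcup_(k in [set k | (k <= m)%N]) range (sigL (strings_of_length k) F).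

Definition injective_factorization F H (f : range H -> Y) :=
  injective f /\ F = f \o corange H.

End Strings.

(* Main.v *)
(* If [F = f \o H] with [f] injective, then [F] and [H] have the same kernel, so
   associativity of [H] (which gives [H \o H = H]) amounts to preassociativity of
   [F].  Conversely, for a quasi-inverse [g] of [F], the map [H = g \o F] satisfies
   [F \o H = F] and has the kernel of [F]; preassociativity of [F] then makes
   [H] associative. *)
Require Import Defs.
From mathcomp Require Import all_boot.
From mathcomp Require Import boolp classical_sets functions.

Local Open Scope classical_set_scope.

(** The union of the ranges of the restrictions always lies in [range F], and it is the image of
    [strings_upto m]. Only the reverse inclusion carries information, and this is the form that
    choice of preimages consumes. *)
Lemma m_determined_rangeP (X Y : Type) (m : nat) (F : seq X -> Y) :
  m_determined_range m F <-> range F `<=` F @` strings_upto m.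
Proof.
rewrite /m_determined_range; split=> [-> _ [k km [x _ <-]]|FS].
  by exists (val x) => //; exists k => //; exact: set_mem (valP x).
apply/seteqP; split=> [y /FS [x [k km xk] <-]|_ [k km [x _ <-]]].
  by exists k => //; exists (SigSub (mem_set xk)).
by exists (val x).
Qed.

Section QuasiInverse.
Context {A B : Type} {f : A -> B}.

(** The axiom of choice enters here: each value of [f] gets a preimage inside [S]. Taking [range f]
    itself as the domain makes the range condition of a quasi-inverse automatic. *)
Lemma exists_quasi_inverse (S : set A) : range f `<=` f @` S ->
  exists g : range f -> A, quasi_inverse f g /\ range g `<=` S.
Proof.
move=> fS; have ex (b : range f) : exists a, S a /\ f a = val b.
  by have [a Sa fab] := fS _ (set_mem (valP b)); exists a.
have [g gP] := choice ex; exists g; split; last first.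
  by move=> _ [b _ <-]; have [] := gP b.
split=> // [b _|]; first by have [] := gP b.
apply/seteqP; split=> _ [b _ <-]; first by exists b.
by exists b => //; exact: set_mem (valP b).
Qed.

Context {D : set B} {g : D -> A} (hg : quasi_inverse f g).

Lemma quasi_inverse_compK a : f (quasi_inverse_comp hg a) = f a.
Proof. by rewrite (quasi_inverse_id hg) //; exact: imageT. Qed.

(** On [range f], [f] undoes [g], so [g] is injective there and composing with it leaves the kernel
    of [f] unchanged. *)
Lemma quasi_inverse_comp_eq a a' :
  quasi_inverse_comp hg a = quasi_inverse_comp hg a' <-> f a = f a'.
Proof.
split=> [eqg|eqf]; first by rewrite -(quasi_inverse_compK a) eqg quasi_inverse_compK.
(* The two arguments of [g] have equal values and differ only in their membership proofs. *)
by congr g; apply: val_inj.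
Qed.

End QuasiInverse.

Section Factorization.
Context {X Y : Type} {F : seq X -> Y}.

Lemma str_associative_idem (H : seq X -> seq X) x :
  str_associative H -> H (H x) = H x.
Proof. by move=> /(_ [::] x [::]); rewrite /= !cats0. Qed.

Section FromFactorization.
Context {H : seq X -> seq X} {f : range H -> Y}.
Hypothesis Ff : injective_factorization F f.

Lemma injective_factorization_eq x x' : F x = F x' <-> H x = H x'.
Proof.
have [finj ->] := Ff; split=> [/finj/(congr1 val)//|eqH] /=.
by congr f; apply: val_inj.
Qed.

Lemma injective_factorization_standard : standard H -> standard F.
Proof. by move=> sH x; rewrite injective_factorization_eq. Qed.

Hypothesis assocH : str_associative H.

(** Since [F] and [H] share their kernel, it suffices to replace [y] by [H y], then by [H y'], and
    return to [y'], using associativity twice. *)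
Lemma injective_factorization_preassociative : preassociative F.
Proof.
move=> x y y' z; rewrite !injective_factorization_eq => eqH.
by rewrite assocH eqH -assocH.
Qed.

Lemma injective_factorization_absorb x : F (H x) = F x.
Proof. by rewrite injective_factorization_eq; exact: str_associative_idem. Qed.

(** The value [F x] is also attained at [H x], whose length is at most [m]. *)
Lemma injective_factorization_m_determined m :
  m_bounded m H -> m_determined_range m F.
Proof.
move=> Hm; apply/m_determined_rangeP => _ [x _ <-].
exists (H x); last exact: injective_factorization_absorb.
by exists (size (H x)) => //; exact: Hm.
Qed.

(** A point of [range H] has the form [H x], and both maps send it to [F x]: [f] by the
    factorization, [F] because it absorbs [H]. *)
Lemma injective_factorization_restriction : f = sigL (range H) F.
Proof.
apply/funext => b; have [x _ Hx] := set_mem (valP b).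
rewrite /sigL /= -[set_val b]/(val b) -Hx injective_factorization_absorb.
by have [_ ->] := Ff; rewrite /=; congr f; exact: val_inj.
Qed.

Lemma injective_factorization_inverse :
  quasi_inverse F (D := range f) (fun y => val (range_inv y)).
Proof.
have fE b : F (val b) = f b by rewrite injective_factorization_restriction.
(* The domain [range f] contains no point outside [range F], so restricting the inverse to [range F]
   loses none of its values. *)
have Ran (d : range f) : range F (val d) by rewrite -range_invK -fE; exact: imageT.
split=> [_ [x _ <-]|d _|]; last 1 first.
- by apply/seteqP; split=> _ [d _ <-]; exists d => //; exact: Ran.
- by have [_ ->] := Ff; exact: imageT.
- by rewrite fE range_invK.
Qed.

End FromFactorization.

Section FromQuasiInverse.
Context {D : set Y} {g : D -> seq X} (hg : quasi_inverse F g).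

(** With [H] equal to [g] after [F], equality under [H] is equality under [F], and [F (H y) = F y]
    is exactly what preassociativity needs to exchange [y] for [H y]. *)
Lemma quasi_inverse_comp_associative :
  preassociative F -> str_associative (quasi_inverse_comp hg).
Proof.
move=> Fpre x y z; apply/(quasi_inverse_comp_eq hg); apply: Fpre.
by rewrite quasi_inverse_compK.
Qed.

Lemma quasi_inverse_comp_standard :
  standard F -> standard (quasi_inverse_comp hg).
Proof. by move=> sF x; rewrite quasi_inverse_comp_eq. Qed.

Lemma quasi_inverse_comp_m_bounded m :
  range g `<=` strings_upto m -> m_bounded m (quasi_inverse_comp hg).
Proof.
move=> gm x; have /gm[k km xk] : range g (quasi_inverse_comp hg x) by exact: imageT.
by rewrite xk.
Qed.

Lemma quasi_inverse_comp_factorization :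
  exists f : range (quasi_inverse_comp hg) -> Y, injective_factorization F f.
Proof.
(* The restriction of [F] is the only possible factor. It is injective because [F] takes the same
   value at [x] and at its image under the composite, and equal values of [F] give equal images. *)
exists (sigL _ F); split; last first.
  by apply/funext => x; rewrite /sigL /= -[LHS](quasi_inverse_compK hg).
move=> b b'; have [x _ Hx] := set_mem (valP b).
have [x' _ Hx'] := set_mem (valP b').
rewrite /sigL /= -[set_val b]/(val b) -[set_val b']/(val b') -Hx -Hx'.
rewrite !quasi_inverse_compK => /(quasi_inverse_comp_eq hg) eqH.
by apply: val_inj; rewrite -Hx -Hx'.
Qed.

End FromQuasiInverse.

Lemma exists_unrestricted_quasi_inverse :
  exists g : range F -> seq X, quasi_inverse F g.
Proof.
by have [y [x _ <-]|g [hg _]] := exists_quasi_inverse (f := F) setT; [exists x|exists g].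
Qed.

Lemma exists_bounded_quasi_inverse m : m_determined_range m F ->
  exists g : range F -> seq X, quasi_inverse F g /\ range g `<=` strings_upto m.
Proof. by move=> /m_determined_rangeP; exact: exists_quasi_inverse. Qed.

End Factorization.

Theorem theorem3p10 (X Y : Type) (hX : inhabited X) (hY : inhabited Y)
    (F : seq X -> Y) :
  (preassociative F <->
     (exists (H : seq X -> seq X) (f : range H -> Y),
        str_associative H /\ injective_factorization F f))
  /\
  (forall (H : seq X -> seq X) (f : range H -> Y),
     str_associative H -> injective_factorization F f ->
     f = sigL (range H) F /\
     quasi_inverse F (D := range f) (fun y => val (range_inv y)) /\
     (forall (D : set Y) (g : D -> seq X) (hg : quasi_inverse F g),
        str_associative (quasi_inverse_comp hg) /\
        exists f' : range (quasi_inverse_comp hg) -> Y,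
          injective_factorization F f'))
  /\
  (preassociative F /\ standard F <->
     (exists (H : seq X -> seq X) (f : range H -> Y),
        str_associative H /\ standard H /\ injective_factorization F f))
  /\
  (forall (H : seq X -> seq X) (f : range H -> Y),
     str_associative H -> standard H -> injective_factorization F f ->
     f = sigL (range H) F /\
     quasi_inverse F (D := range f) (fun y => val (range_inv y)) /\
     (forall (D : set Y) (g : D -> seq X) (hg : quasi_inverse F g),
        str_associative (quasi_inverse_comp hg) /\ standard (quasi_inverse_comp hg) /\
        exists f' : range (quasi_inverse_comp hg) -> Y,
          injective_factorization F f'))
  /\
  (forall m : nat,
    (preassociative F /\ m_determined_range m F <->
       (exists (H : seq X -> seq X) (f : range H -> Y),
          str_associative H /\ m_bounded m H /\ injective_factorization F f))
    /\
    (forall (H : seq X -> seq X) (f : range H -> Y),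
       str_associative H -> m_bounded m H -> injective_factorization F f ->
       f = sigL (range H) F /\
       quasi_inverse F (D := range f) (fun y => val (range_inv y)) /\
       (forall (D : set Y) (g : D -> seq X) (hg : quasi_inverse F g),
          range g `<=` strings_upto m ->
          str_associative (quasi_inverse_comp hg)
          /\ m_bounded m (quasi_inverse_comp hg) /\
          exists f' : range (quasi_inverse_comp hg) -> Y,
            injective_factorization F f'))
    /\
    (preassociative F /\ standard F /\ m_determined_range m F <->
       (exists (H : seq X -> seq X) (f : range H -> Y),
          str_associative H /\ standard H
          /\ m_bounded m H /\ injective_factorization F f))
    /\
    (forall (H : seq X -> seq X) (f : range H -> Y),
       str_associative H -> standard H -> m_bounded m H ->
       injective_factorization F f ->
       f = sigL (range H) F /\
       quasi_inverse F (D := range f) (fun y => val (range_inv y)) /\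
       (forall (D : set Y) (g : D -> seq X) (hg : quasi_inverse F g),
          range g `<=` strings_upto m ->
          str_associative (quasi_inverse_comp hg) /\ standard (quasi_inverse_comp hg)
          /\ m_bounded m (quasi_inverse_comp hg) /\
          exists f' : range (quasi_inverse_comp hg) -> Y,
            injective_factorization F f'))).
Proof.
have Inv := @injective_factorization_inverse X Y F.
have Res := @injective_factorization_restriction X Y F.
have Pre := @injective_factorization_preassociative X Y F.
have Sta := @injective_factorization_standard X Y F.
have Det := @injective_factorization_m_determined X Y F.
have qAss := @quasi_inverse_comp_associative X Y F.
have qSta := @quasi_inverse_comp_standard X Y F.
have qBnd := @quasi_inverse_comp_m_bounded X Y F.
have qFac := @quasi_inverse_comp_factorization X Y F.
(* This one quasi-inverse serves both equivalences without a length bound. *)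
have [g0 hg0] := @exists_unrestricted_quasi_inverse X Y F.
split; last split; last split; last split.
- split=> [Fp|[H [f [aH Ff]]]]; last by eauto 10.
  by have [f Ff] := qFac _ _ hg0; exists (quasi_inverse_comp hg0), f; eauto 10.
- move=> H f aH Ff; split; first exact: Res.
  (* For an arbitrary [g], preassociativity of [F] is first recovered from the given [H] and [f],
     then transferred to the new composite. *)
  by split=> [|D g hg]; [exact: Inv|eauto 10].
- split=> [[Fp Fs]|[H [f [aH [sH Ff]]]]]; last by eauto 10.
  by have [f Ff] := qFac _ _ hg0; exists (quasi_inverse_comp hg0), f; eauto 10.
- move=> H f aH sH Ff; split; first exact: Res.
  by split=> [|D g hg]; [exact: Inv|eauto 10].
(* With a bound, the quasi-inverse must select strings of length at most [m], so it depends on [m]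
   and on the determined range. *)
- move=> m; have gm := @exists_bounded_quasi_inverse X Y F m.
  split; last split; last split.
  + split=> [[Fp /gm[g [hg gS]]]|[H [f [aH [bH Ff]]]]]; last by eauto 10.
    by have [f Ff] := qFac _ _ hg; exists (quasi_inverse_comp hg), f; eauto 10.
  + move=> H f aH bH Ff; split; first exact: Res.
    by split=> [|D g hg gS]; [exact: Inv|eauto 10].
  + split=> [[Fp [Fs /gm[g [hg gS]]]]|[H [f [aH [sH [bH Ff]]]]]]; last by eauto 10.
    by have [f Ff] := qFac _ _ hg; exists (quasi_inverse_comp hg), f; eauto 10.
  + move=> H f aH sH bH Ff; split; first exact: Res.
    by split=> [|D g hg gS]; [exact: Inv|eauto 10].
Qed.
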